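(* Let $m,n\ge 1$, let $\mathbb K$ be a field, $q\in\mathbb K^*$, and let $\mathcal A$ be a $\mathbb K$-algebra. Let $f,g:\mathcal E^{m,n}\to\mathcal A-\{0\}$ be RQI-functions (normalized by $f(\emptyset|\emptyset)=g(\emptyset|\emptyset)=1$) that coincide on $Pint_{m,n}$. Suppose, in addition, that for every $(I|J)\in\mathcal E^{m,n}$ the element $f(I|J)$ is not a zerodivisor in $\mathcal A$. Then $f(I|J)=g(I|J)$ for all $(I|J)\in\mathcal E^{m,n}$.
   Context: Algebras are associative and unital, not necessarily commutative. $[n']=\{1,\dots,n'\}$. An interval in $[n']$ is a set $[a..b]=\{a,a+1,\dots,b\}$ with $1\le a\le b\le n'$. For a set $A$ and elements $a,\dots,b\notin A$, $Aa\ldots b$ denotes $A\cup\{a,\dots,b\}$. $\mathcal E^{m,n}$ is the set of pairs (corteges) $(I|J)$ with $I\subseteq[m]$, $J\subseteq[n]$, $|I|=|J|$ (including $(\emptyset|\emptyset)$). $Pint_{m,n}$ (pressed interval corteges) is the set of $(I|J)\in\mathcal E^{m,n}$ such that $I$ and $J$ are both intervals and at least one of $I=[|I|]$, $J=[|J|]$ holds. A function $f:\mathcal E^{m,n}\to\mathcal A$ is an RQI-function if it satisfies the following three families of relations. (P) Plücker-type: for all $A\subset[m]$, $B\subset[n]$, $i<j<k$ in $[m]-A$, $\ell\in[n]-B$ with $|A|+1=|B|$: $$f(Aj|B)f(Aik|B\ell)=f(Aij|B\ell)f(Ak|B)+f(Ajk|B\ell)f(Ai|B).$$ (P* ) Co-Plücker-type: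 for all $A\subset[m]$, $B\subset[n]$, $\ell\in[m]-A$, $i<j<k$ in $[n]-B$ with $|A|=|B|+1$: $$f(A|Bj)f(A\ell|Bik)=f(A\ell|Bij)f(A|Bk)+f(A\ell|Bjk)f(A|Bi).$$ (D) Dodgson-type: for all $i,k\in[m]$, $j,\ell\in[n]$ with $k-i=\ell-j>0$, putting $A:=\{i+1,\dots,k-1\}$ and $B:=\{j+1,\dots,\ell-1\}$ (possibly empty): $$f(Ai|Bj)f(Ak|B\ell)=f(Aik|Bj\ell)f(A|B)+q\,f(Ai|B\ell)f(Ak|Bj).$$ All functions on $\mathcal E^{m,n}$ are assumed normalized: $f(\emptyset|\emptyset)=1$. An element $a$ of a ring is a zerodivisor if $ax=0$ or $xa=0$ for some $x\neq 0$. *)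

(* Defs.v *)
From HB Require Import structures.
From mathcomp Require Import all_boot all_order all_algebra.

Set Implicit Arguments.
Unset Strict Implicit.
Unset Printing Implicit Defensive.

Import Order.TTheory GRing.Theory Num.Theory.

Local Open Scope ring_scope.

(* The index set [n] = {1, ..., n} is represented by 'I_n = {0, ..., n-1}; all
   conditions below are invariant under this shift, with the initial interval
   [p] = {1, ..., p} becoming {x | x < p}. *)

Definition cortege (m n : nat) (I : {set 'I_m}) (J : {set 'I_n}) : Prop :=
  #|I| = #|J|.

Definition is_interval (n : nat) (I : {set 'I_n}) : Prop :=
  exists a b : 'I_n, (a <= b)%N /\ I = [set x : 'I_n | (a <= x <= b)%N].

Definition initial_segment (n p : nat) : {set 'I_n} :=
  [set x : 'I_n | (x < p)%N].

Definition Pint (m n : nat) (I : {set 'I_m}) (J : {set 'I_n}) : Prop :=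
  [/\ cortege I J, is_interval I, is_interval J &
      I = initial_segment m #|I| \/ J = initial_segment n #|J|].

Definition open_interval (n : nat) (i k : 'I_n) : {set 'I_n} :=
  [set x : 'I_n | (i < x < k)%N].

Definition zerodivisor (R : nzRingType) (a : R) : Prop :=
  exists x : R, x != 0 /\ (a * x = 0 \/ x * a = 0).

(* A function on corteges is encoded as a total function of the two sets.  Its
   values on pairs of sets of different sizes are junk: every property below
   only involves values f I J with #|I| = #|J|. *)
Section RQI.

Variables (K : fieldType) (A : algType K) (m n : nat).

Implicit Type f : {set 'I_m} -> {set 'I_n} -> A.

Definition pluecker f : Prop :=
  forall (X : {set 'I_m}) (Y : {set 'I_n}) (i j k : 'I_m) (l : 'I_n),
    (#|X| + 1 = #|Y|)%N ->
    (i < j)%N -> (j < k)%N ->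
    i \notin X -> j \notin X -> k \notin X -> l \notin Y ->
    f (X :|: [set j]) Y * f (X :|: [set i; k]) (Y :|: [set l])
    = f (X :|: [set i; j]) (Y :|: [set l]) * f (X :|: [set k]) Y
      + f (X :|: [set j; k]) (Y :|: [set l]) * f (X :|: [set i]) Y.

Definition co_pluecker f : Prop :=
  forall (X : {set 'I_m}) (Y : {set 'I_n}) (l : 'I_m) (i j k : 'I_n),
    (#|X| = #|Y| + 1)%N ->
    (i < j)%N -> (j < k)%N ->
    l \notin X -> i \notin Y -> j \notin Y -> k \notin Y ->
    f X (Y :|: [set j]) * f (X :|: [set l]) (Y :|: [set i; k])
    = f (X :|: [set l]) (Y :|: [set i; j]) * f X (Y :|: [set k])
      + f (X :|: [set l]) (Y :|: [set j; k]) * f X (Y :|: [set i]).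

(* The subtraction is truncated, but 0 < k - i forces i < k and j < l. *)
Definition dodgson (q : K) f : Prop :=
  forall (i k : 'I_m) (j l : 'I_n),
    (k - i = l - j)%N -> (0 < k - i)%N ->
    let X := open_interval i k in
    let Y := open_interval j l in
    f (X :|: [set i]) (Y :|: [set j]) * f (X :|: [set k]) (Y :|: [set l])
    = f (X :|: [set i; k]) (Y :|: [set j; l]) * f X Y
      + q *: (f (X :|: [set i]) (Y :|: [set l])
              * f (X :|: [set k]) (Y :|: [set j])).

Definition RQI_function (q : K) f : Prop :=
  [/\ pluecker f, co_pluecker f & dodgson q f].

Definition normalized f : Prop := f set0 set0 = 1.

Definition nowhere_zero f : Prop :=
  forall (I : {set 'I_m}) (J : {set 'I_n}), cortege I J -> f I J != 0.

End RQI.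

(* Main.v *)
Require Import Defs.
From mathcomp Require Import all_boot all_order all_algebra.
From mathcomp Require Import zify.

Set Implicit Arguments.
Unset Strict Implicit.
Unset Printing Implicit Defensive.

Import Order.TTheory GRing.Theory Num.Theory.

Local Open Scope ring_scope.

(** Each relation expresses one value of f in terms of others, up to a left
    factor that can be cancelled.  For the intervals (a+1..a+p | b+1..b+p), the
    Dodgson relation involves otherwise only triples (a', b', p') with a smaller
    sum a' + b' + p', and the triples with a = 0 or b = 0 are pressed.  If I is
    not an interval, apply the Pluecker relation to i = min I, k = max I and a
    j outside I between them: the other terms have smaller size or the same size
    and a first component with a smaller hull.  Likewise for J with the
    co-Pluecker relation. *)

Lemma mulrI_nonzerodivisor (R : nzRingType) (a x y : R) :
  ~ zerodivisor a -> a * x = a * y -> x = y.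
Proof.
move=> a_reg eq_ax; apply/eqP; rewrite -subr_eq0; apply/negP => /negP xy_neq0.
by apply: a_reg; exists (x - y); split=> //; left; rewrite mulrBr eq_ax subrr.
Qed.

(** The least interval containing [I], written without extreme elements so that it also makes sense,
    as the empty set, for [I] empty. *)
Definition hull (n : nat) (I : {set 'I_n}) : {set 'I_n} :=
  [set x : 'I_n | [exists a in I, (a <= x)%N] && [exists b in I, (x <= b)%N]].

(** The point [x] is in [hull I] but not in [hull I'], all of [I'] being strictly on one side of it.
    Inclusion in [hull I] rather than in [I] is asked because [I'] will contain a gap of [I]. *)
Lemma hull_proper (n : nat) (I I' : {set 'I_n}) (x : 'I_n) :
  I' \subset hull I -> x \in I ->
  (forall y, y \in I' -> (x < y)%N) \/ (forall y, y \in I' -> (y < x)%N) ->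
  (#|hull I'| < #|hull I|)%N.
Proof.
move=> /subsetP sI'I xI x_out; apply/proper_card/properP; split.
  apply/subsetP => y; rewrite !inE => /andP[].
  case/exists_inP=> a /sI'I; rewrite inE => /andP[/exists_inP[a' Ia' a'a] _] ay.
  case/exists_inP=> b /sI'I; rewrite inE => /andP[_ /exists_inP[b' Ib' b'b]] yb.
  apply/andP; split; apply/exists_inP.
    by exists a' => //; apply: leq_trans ay.
  by exists b' => //; apply: leq_trans b'b.
exists x; first by rewrite inE; apply/andP; split; apply/exists_inP; exists x.
rewrite inE; apply/negP => /andP[/exists_inP[a aI' ax] /exists_inP[b bI' xb]].
by case: x_out => x_out; [move: (x_out _ aI') | move: (x_out _ bI')]; lia.
Qed.

Lemma interval_or_gap (n : nat) (I : {set 'I_n}) :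
  I != set0 ->
  is_interval I \/
  exists i j k : 'I_n, [/\ (i < j < k)%N, i \in I, k \in I, j \notin I &
    forall x, x \in I -> (i <= x <= k)%N].
Proof.
case/set0Pn=> x0 x0I.
have [i iI i_min] := @arg_minnP _ x0 (mem I) (@nat_of_ord n) x0I.
have [k kI k_max] := @arg_maxnP _ x0 (mem I) (@nat_of_ord n) x0I.
have I_ik x : x \in I -> (i <= x <= k)%N.
  by move=> xI; apply/andP; split; [apply: i_min | apply: k_max].
have [/existsP[j /andP[j_ik jI]] | no_gap] :=
  boolP [exists j : 'I_n, (i <= j <= k)%N && (j \notin I)].
  right; exists i, j, k; split=> //; move/andP: j_ik => [ij jk].
  rewrite !ltn_neqAle ij jk !andbT; apply/andP; split.
    by apply: contraNneq jI => /val_inj <-.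
  by apply: contraNneq jI => /val_inj ->.
left; exists i, k; split; first by case/andP: (I_ik k kI).
apply/setP=> x; rewrite inE; apply/idP/idP; first exact: I_ik.
move=> x_ik; apply: contraNT no_gap => xI.
by apply/existsP; exists x; rewrite x_ik.
Qed.

Section Pluecker.

Variables (K : fieldType) (A : algType K) (m n : nat).
Variables f g : {set 'I_m} -> {set 'I_n} -> A.
Hypothesis f_reg : forall I J, cortege I J -> ~ zerodivisor (f I J).

(** Write [I = Xik] and [J = Yl]. The factors with column set [Y] have smaller size, and those with
    [Xij] and [Xjk] each lose an extreme element of [I]. The latter two keep the column set [J], so
    the second induction hypothesis varies only [I']. *)
Lemma pluecker_determined (I : {set 'I_m}) (J : {set 'I_n}) :
  pluecker f -> pluecker g -> I != set0 -> cortege I J ->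
  (forall (I' : {set 'I_m}) (J' : {set 'I_n}), (#|I'| < #|I|)%N ->
    cortege I' J' -> f I' J' = g I' J') ->
  (forall I' : {set 'I_m}, #|I'| = #|I| -> (#|hull I'| < #|hull I|)%N ->
    f I' J = g I' J) ->
  is_interval I \/ f I J = g I J.
Proof.
move=> Pf Pg I_neq0 IJ IHsize IHhull.
have [|[i [j [k [/andP[ij jk] iI kI jI I_ik]]]]] := interval_or_gap I_neq0.
  by left.
right.
have ki : k != i by rewrite -val_eqE /=; lia.
set X := I :\ i :\ k.
have cardX : #|I| = #|X|.+2.
  by rewrite (cardsD1 i) iI (cardsD1 k) !inE ki kI.
(* Any element of [J] will do, since the relation puts no order condition on [l]. *)
have [l lJ] : exists l, l \in J.
  by apply/set0Pn; rewrite -card_gt0 -IJ card_gt0.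
set Y := J :\ l.
have cardY : #|J| = #|Y|.+1 by rewrite (cardsD1 l) lJ.
have XY : (#|X| + 1 = #|Y|)%N by move: IJ; rewrite /cortege cardX cardY; lia.
have defI : X :|: [set i; k] = I.
  by apply/setP=> x; rewrite !inE; case: eqP => [->|]; case: eqP => [->|];
     rewrite ?iI ?kI ?orbT ?orbF.
have defJ : Y :|: [set l] = J by rewrite setUC setD1K.
have iX : i \notin X by rewrite !inE eqxx andbF.
have kX : k \notin X by rewrite !inE eqxx.
have jX : j \notin X by rewrite !inE (negPf jI) !andbF.
have X_ik x : x \in X -> (i < x < k)%N.
  rewrite !inE => /and3P[xk xi /I_ik].
  by move: xk xi; rewrite -!val_eqE /=; lia.
have card1 x : x \notin X -> #|X :|: [set x]| = #|X|.+1.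
  by move=> xX; rewrite setUC cardsU1 xX.
have card2 x y : x \notin X -> y \notin X -> x != y ->
    #|X :|: [set x; y]| = #|I|.
  move=> xX yX xy; rewrite setUA setUC cardsU1 card1 // cardX.
  by rewrite in_setU in_set1 negb_or yX eq_sym xy.
have fg1 x : x \notin X -> f (X :|: [set x]) Y = g (X :|: [set x]) Y.
  by move=> xX; apply: IHsize; rewrite /cortege card1 // ?cardX // -XY addn1.
(* Here [z] is the endpoint of [I] that is replaced by [j]: [k] for [Xij] and [i] for [Xjk]. *)
have fg2 x y z : x \notin X -> y \notin X -> x != y ->
    (i <= x <= k)%N -> (i <= y <= k)%N -> z \in I ->
    (forall w, w \in X :|: [set x; y] -> (z < w)%N) \/
    (forall w, w \in X :|: [set x; y] -> (w < z)%N) ->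
    f (X :|: [set x; y]) J = g (X :|: [set x; y]) J.
  move=> xX yX xy x_ik y_ik zI z_out.
  apply: IHhull; first exact: card2.
  apply: (hull_proper _ zI z_out); apply/subsetP => w w_in.
  suff /andP[iw wk] : (i <= w <= k)%N.
    by rewrite inE; apply/andP; split; apply/exists_inP; [exists i | exists k].
  move: w_in; rewrite in_setU in_set2.
  by case/or3P=> [/X_ik | /eqP-> | /eqP->] //; lia.
have fg_ij : f (X :|: [set i; j]) J = g (X :|: [set i; j]) J.
  apply: (fg2 i j k) => //; rewrite -?val_eqE /=; try lia.
  right=> w; rewrite in_setU in_set2.
  by case/or3P=> [/X_ik | /eqP-> | /eqP->]; lia.
have fg_jk : f (X :|: [set j; k]) J = g (X :|: [set j; k]) J.
  apply: (fg2 j k i) => //; rewrite -?val_eqE /=; try lia.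
  left=> w; rewrite in_setU in_set2.
  by case/or3P=> [/X_ik | /eqP-> | /eqP->]; lia.
have lY : l \notin Y by rewrite !inE eqxx.
have := Pg X Y i j k l XY ij jk iX jX kX lY.
have := Pf X Y i j k l XY ij jk iX jX kX lY.
(* Both relations now have the same right-hand side, so [g(Xj|Y) f(I|J) = g(Xj|Y) g(I|J)].
   Regularity is assumed for [f], so the common factor is turned back into [f(Xj|Y)] before
   cancelling. *)
rewrite defI defJ fg_ij fg_jk !fg1 // => <- /esym; apply: mulrI_nonzerodivisor.
by rewrite -fg1 //; apply: f_reg; rewrite /cortege card1 // -XY addn1.
Qed.

End Pluecker.

(** Exchanging rows and columns preserves the order of every product, so the algebra need not be
    replaced by its opposite. *)
Lemma pluecker_transpose (K : fieldType) (A : algType K) (m n : nat)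
    (f : {set 'I_m} -> {set 'I_n} -> A) :
  co_pluecker f -> pluecker (fun J I => f I J).
Proof.
by move=> coPf X Y i j k l XY ij jk iX jX kX lY; apply: coPf.
Qed.

(** Offset and length are natural numbers in order to allow [p = 0]: the inner set of a Dodgson
    relation may be empty. *)
Definition segment (n a p : nat) : {set 'I_n} :=
  [set x : 'I_n | (a <= x < a + p)%N].

Lemma segment0 (n a : nat) : segment n a 0 = set0.
Proof. by apply/setP=> x; rewrite !inE; lia. Qed.

Lemma card_segment (n a p : nat) : (a + p <= n)%N -> #|segment n a p| = p.
Proof.
elim: p => [|p IHp] ap; first by rewrite segment0 cards0.
have ap_lt : (a + p < n)%N by lia.
have -> : segment n a p.+1 = Ordinal ap_lt |: segment n a p.
  by apply/setP=> x; rewrite !inE -val_eqE /=; lia.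
by rewrite cardsU1 IHp ?inE /=; lia.
Qed.

Lemma segment_interval (n a p : nat) :
  (0 < p)%N -> (a + p <= n)%N -> is_interval (segment n a p).
Proof.
move=> p_gt0 ap; have a_lt : (a < n)%N by lia.
have b_lt : (a + p.-1 < n)%N by lia.
exists (Ordinal a_lt), (Ordinal b_lt); split=> /=; first by lia.
by apply/setP=> x; rewrite !inE /=; lia.
Qed.

Lemma interval_segment (n : nat) (I : {set 'I_n}) :
  is_interval I -> exists2 a, (a + #|I| <= n)%N & I = segment n a #|I|.
Proof.
case=> a [b [ab defI]]; have lt_b := ltn_ord b.
have defI' : I = segment n a (b - a).+1.
  by rewrite defI; apply/setP=> x; rewrite !inE; lia.
have cardI : #|I| = (b - a).+1 by rewrite defI' card_segment; lia.
by exists a; rewrite cardI //; lia.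
Qed.

Lemma segment_initial (n p : nat) : segment n 0 p = initial_segment n p.
Proof. by apply/setP=> x; rewrite !inE. Qed.

Lemma open_interval_segment (n a p : nat) (i k : 'I_n) :
  i = a :> nat -> k = (a + p.+1)%N :> nat ->
  [/\ open_interval i k = segment n a.+1 p,
      open_interval i k :|: [set i] = segment n a p.+1,
      open_interval i k :|: [set k] = segment n a.+1 p.+1 &
      open_interval i k :|: [set i; k] = segment n a p.+2].
Proof.
by move=> ia ka; split; apply/setP=> x; rewrite !inE -?val_eqE /= ia ka; lia.
Qed.

Section Determined.

Variables (K : fieldType) (A : algType K) (m n : nat) (q : K).
Variables f g : {set 'I_m} -> {set 'I_n} -> A.
Hypothesis f_reg : forall I J, cortege I J -> ~ zerodivisor (f I J).
Hypothesis fg_Pint : forall I J, Pint I J -> f I J = g I J.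
Hypotheses (f_norm : normalized f) (g_norm : normalized g).

(** The unknown is the factor [f(Ak|Bl)]. The term [f(Aik|Bjl)] has larger size but starts one place
    earlier in both rows and columns, which is why the induction is on [a + b + p] and not on
    size. *)
Lemma dodgson_determined (a b p : nat) :
  dodgson q f -> dodgson q g -> (a + p <= m)%N -> (b + p <= n)%N ->
  f (segment m a p) (segment n b p) = g (segment m a p) (segment n b p).
Proof.
move=> Df Dg; have [N] := ubnP (a + b + p).
elim: N a b p => // N IHN a b [|p] ltN ap bp.
  by rewrite !segment0 f_norm g_norm.
have pressed (ab0 : a = 0%N \/ b = 0%N) :
    f (segment m a p.+1) (segment n b p.+1) =
    g (segment m a p.+1) (segment n b p.+1).
  apply: fg_Pint; split; try exact: segment_interval.
    by rewrite /cortege !card_segment.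
  by rewrite !card_segment //; case: ab0 => ->; rewrite segment_initial; auto.
case: a ltN ap pressed => [|a] ltN ap pressed; first by apply: pressed; left.
case: b ltN bp pressed => [|b] ltN bp pressed; first by apply: pressed; right.
(* The target now has offsets [a.+1], [b.+1] and length [p.+1]; it is [(Ak|Bl)] for [i = a],
   [k = a + p.+1], [j = b], [l = b + p.+1]. *)
have lt_i : (a < m)%N by lia.
have lt_k : (a + p.+1 < m)%N by lia.
have lt_j : (b < n)%N by lia.
have lt_l : (b + p.+1 < n)%N by lia.
have eq_len : (Ordinal lt_k - Ordinal lt_i = Ordinal lt_l - Ordinal lt_j)%N.
  by rewrite /=; lia.
have gt0_len : (0 < Ordinal lt_k - Ordinal lt_i)%N by rewrite /=; lia.
have /= := Dg _ _ _ _ eq_len gt0_len; have /= := Df _ _ _ _ eq_len gt0_len.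
have [-> -> -> ->] := @open_interval_segment m a p (Ordinal lt_i) (Ordinal lt_k)
  erefl erefl.
have [-> -> -> ->] := @open_interval_segment n b p (Ordinal lt_j) (Ordinal lt_l)
  erefl erefl.
(* The length is left free for offsets [a], [b], where both [p.+1] and [p.+2] occur. It is fixed to
   [p] for [a.+1], [b.+1], so that the target of length [p.+1] is not rewritten. *)
rewrite !(IHN a b, IHN a.+1 b.+1 p, IHN a.+1 b, IHN a b.+1); try lia.
move=> <- /esym; apply: mulrI_nonzerodivisor.
rewrite -IHN; try lia; apply: f_reg.
by rewrite /cortege !card_segment //; lia.
Qed.

(** The outer induction is on size, the inner one on the sum of the two hull sizes, since each
    Pluecker step shrinks one hull and fixes the other set. Pairs of intervals are settled
    separately, because the Dodgson step may increase the size. *)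
Lemma RQI_determined (I : {set 'I_m}) (J : {set 'I_n}) :
  RQI_function q f -> RQI_function q g -> cortege I J -> f I J = g I J.
Proof.
case=> Pf coPf Df [Pg coPg Dg].
have [p] := ubnP #|I|; elim: p I J => // p IHsize I J.
have [h] := ubnP (#|hull I| + #|hull J|).
elim: h I J => // h IHhull I J lt_h lt_p IJ.
(* The empty set is not an interval in the sense of [is_interval]; normalization covers it. *)
have [I0|I_neq0] := eqVneq I set0.
  have J0 : J = set0 by apply/eqP; rewrite -cards_eq0 -IJ I0 cards0.
  by rewrite I0 J0 f_norm g_norm.
have J_neq0 : J != set0 by rewrite -card_gt0 -IJ card_gt0.
have [] // := pluecker_determined f_reg Pf Pg I_neq0 IJ.
- by move=> I' J' lt_I' IJ'; apply: IHsize => //; lia.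
- by move=> I' eq_I' hull_I'; apply: IHhull; rewrite /cortege ?eq_I' //; lia.
move=> /interval_segment[a ap defI].
have [] // := @pluecker_determined _ _ _ _ (fun J I => f I J) (fun J I => g I J)
  (fun J I JI => f_reg (esym JI)) J I (pluecker_transpose coPf)
  (pluecker_transpose coPg) J_neq0 (esym IJ).
- by move=> J' I' lt_J' JI'; apply: IHsize; [move: IJ JI'; rewrite /cortege; lia|].
- by move=> J' eq_J' hull_J'; apply: IHhull; rewrite /cortege ?eq_J' //; lia.
move=> /interval_segment[b]; rewrite -IJ => bp defJ.
by rewrite defI defJ; apply: dodgson_determined.
Qed.

End Determined.

Theorem theorem1p1 (m n : nat) (m_ge1 : (1 <= m)%N) (n_ge1 : (1 <= n)%N)
    (K : fieldType) (q : K) (q_neq0 : q != 0) (A : algType K)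
    (f g : {set 'I_m} -> {set 'I_n} -> A)
    (f_neq0 : nowhere_zero f) (g_neq0 : nowhere_zero g)
    (f_norm : normalized f) (g_norm : normalized g)
    (f_RQI : RQI_function q f) (g_RQI : RQI_function q g)
    (fg_Pint : forall (I : {set 'I_m}) (J : {set 'I_n}),
        Pint I J -> f I J = g I J)
    (f_reg : forall (I : {set 'I_m}) (J : {set 'I_n}),
        cortege I J -> ~ zerodivisor (f I J)) :
  forall (I : {set 'I_m}) (J : {set 'I_n}), cortege I J -> f I J = g I J.
Proof.
move=> I J; exact: (RQI_determined f_reg fg_Pint f_norm g_norm f_RQI g_RQI).
Qed.
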